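(* Let $b\ge 2$ be an integer such that both $b$ and $b-4$ are squarefree, let $D:=b^2-4b$, and let $p\ge 3$ be a prime such that $D\not\equiv 0\pmod{p}$. Let $V_p$ be the $p$-th term of the sequence defined by $V_0=2$, $V_1=-b$, $V_n=-bV_{n-1}-bV_{n-2}$ for $n\ge 2$. If \[V_p\equiv -b\pmod{p^2}\quad\text{and}\quad b^{p-1}\equiv 1\pmod{p^2},\] then the polynomial $\mathcal{G}_{p,b}(x):=x^{2p}+bx^p+b$ is not monogenic.
   Context: A monic polynomial $f(x)\in\mathbb{Z}[x]$ of degree $N\ge 2$ is called monogenic if $f(x)$ is irreducible over $\mathbb{Q}$ and $\{1,\theta,\theta^2,\ldots,\theta^{N-1}\}$ is a basis (over $\mathbb{Z}$) for the ring of integers of $\mathbb{Q}(\theta)$, where $f(\theta)=0$. An integer (possibly negative) is squarefree if it is not divisible by $m^2$ for any integer $m>1$; in particular $0$ is not squarefree. *)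

(* Defs.v *)
From HB Require Import structures.
From mathcomp Require Import all_boot all_order all_algebra all_field.

Set Implicit Arguments.
Unset Strict Implicit.
Unset Printing Implicit Defensive.

Import Order.TTheory GRing.Theory Num.Theory.

Local Open Scope ring_scope.

Definition ring_of_integers (L : fieldExtType rat) (K : {subfield L}) (x : L) :
    Prop :=
  x \in K /\ integralOver (intr : int -> L) x.

Definition is_Zbasis (V : zmodType) (M : V -> Prop) (n : nat) (e : 'I_n -> V) :
    Prop :=
  (forall i, M (e i)) /\
  (forall x, M x -> exists! c : {ffun 'I_n -> int}, x = \sum_i e i *~ c i).

(* The number field Q(theta) is the subfield <<1; theta>> generated by theta in
   an arbitrary finite extension L of rat; the degree of f is (size f).-1. The
   basis condition is invariant under Q-isomorphism, hence does not depend on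
   the choice of L and of the root theta. *)
Definition monogenic (f : {poly int}) : Prop :=
  [/\ f \is monic,
      (2 <= (size f).-1)%N,
      irreducible_poly (map_poly intr f : {poly rat})
    & forall (L : fieldExtType rat) (theta : L),
        root (map_poly intr f) theta ->
        is_Zbasis (ring_of_integers <<1; theta>>%AS)
                  (fun i : 'I_(size f).-1 => theta ^+ i)].

Definition squarefree (a : int) : Prop :=
  forall m : int, 1 < m -> ~~ (m ^+ 2 %| a)%Z.

Fixpoint V (b : int) (n : nat) : int :=
  match n with
  | 0 => 2
  | 1 => - b
  | (m.+1 as k).+1 => - b * V b k - b * V b m
  end.

Definition G (p : nat) (b : int) : {poly int} :=
  'X^(2 * p) + b *: 'X^p + b%:P.

(* Main.v *)
(* Let g = x^2 + b x + b, with roots alpha and beta. The two congruences say that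
   alpha^p + beta^p = -b and alpha^p beta^p = b modulo p^2, so alpha^p and beta^p
   are again roots of g modulo p^2, and G(p, b) = g(x^p) = g q + p^2 r with q
   monic. Reducing modulo p, where G(p, b) = g^p, gives q = g^(p-1) + p s. For a
   root theta of G(p, b), q(theta) / p is then an algebraic integer outside
   Z[theta] (Dedekind's criterion fails at p). *)
Require Import Defs.
From mathcomp Require Import all_boot all_order all_algebra all_field.
From mathcomp Require Import ring zify.

Import Order.TTheory GRing.Theory Num.Theory.

Local Open Scope ring_scope.

Lemma Xn_add_monic_size {R : nzRingType} {n : nat} {u : {poly R}} :
  (size u <= n)%N -> 'X^n + u \is monic /\ size ('X^n + u) = n.+1.
Proof.
move=> szu; have lt_u : (size u < size ('X^n : {poly R}))%N by rewrite size_polyXn.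
by rewrite monicE lead_coefDl // lead_coefXn size_polyDl // size_polyXn.
Qed.

Lemma horner_map_intr_integral {L : fieldExtType rat} {theta : L} (u : {poly int}) :
  integralOver (intr : int -> L) theta ->
  integralOver (intr : int -> L) (map_poly intr u).[theta].
Proof.
apply: integral_horner; apply/integral_poly => i.
by rewrite coef_map; apply: integral_id.
Qed.

(** The basis condition in [monogenic] quantifies over all [L] and [theta], so refuting it requires
    at least one such pair. *)
Lemma root_field_exists {f : {poly int}} :
  irreducible_poly (map_poly intr f : {poly rat}) ->
  exists L : fieldExtType rat, exists theta : L, root (map_poly intr f) theta.
Proof.
case/irredp_FAdjoin => L _ [theta th _]; exists L, theta.
rewrite -map_poly_comp in th; rewrite (eq_map_poly (g := in_alg L \o intr)) // => c.
by rewrite /= -(rmorph_int (in_alg L)).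
Qed.

(* If f is monogenic with root theta, then omega = q(theta) / m is an algebraic
   integer, as omega^2 = s(theta) omega - r(theta) w(theta); but its coordinates
   in the power basis cannot be integral since q is monic. *)
Lemma not_monogenic_of_factorization {m : nat} {f g q r w s : {poly int}} :
  (1 < m)%N -> q \is monic -> (size q < size f)%N ->
  f = g * q + (m%:Z ^+ 2)%:P * r -> q = g * w + m%:Z%:P * s ->
  ~ monogenic f.
Proof.
move=> m1 q_mon szq fE qE [f_mon _ f_irr /= basis].
have [L [theta th]] := root_field_exists f_irr.
have int_theta : integralOver (intr : int -> L) theta by exists f.
have [_ uniq_dec] := basis L theta th.
pose ev u := (map_poly intr u : {poly L}).[theta].
have evM u v : ev (u * v) = ev u * ev v by rewrite /ev rmorphM hornerM.
have evD u v : ev (u + v) = ev u + ev v by rewrite /ev rmorphD hornerD.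
have evC c : ev c%:P = c%:~R by rewrite /ev map_polyC hornerC.
have ev_int u : integralOver intr (ev u) by apply: horner_map_intr_integral.
have evF : ev f = 0 by apply/eqP.
have ev_in u : ev u \in <<1; theta>>%VS.
  rewrite /ev rpred_horner ?memv_adjoin //; apply/polyOverP => i.
  by rewrite coef_map /= rpred_int.
have m0 : (m%:R : L) != 0.
  have /pcharf0P -> : [pchar L] =i pred0.
    by move=> k; rewrite pchar_lalg; apply: pchar_num.
  by rewrite -lt0n ltnW.
have [omega mK omega_in] :
    exists2 omega, omega * m%:R = ev q & omega \in <<1; theta>>%VS.
  by exists (ev q / m%:R); rewrite ?divfK ?rpred_div ?rpred_nat ?ev_in.
(* After multiplication by [m ^ 2], this is q^2 = q (g w + m s) evaluated at [theta], where g q = -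
   m^2 r because f vanishes. *)
have omegaE : omega ^+ 2 = ev s * omega - ev (r * w).
  apply: (mulIf (expf_neq0 2 m0)); rewrite -exprMn mK mulrBl.
  have evC_m : ev m%:Z%:P = m%:R by rewrite evC.
  have Egq : ev g * ev q = - (m%:R ^+ 2 * ev r).
    apply/eqP; rewrite -addr_eq0; move: evF.
    by rewrite fE evD !evM evC rmorphXn /= => ->.
  have -> : ev q ^+ 2 = ev q * (ev g * ev w + m%:R * ev s).
    by rewrite -evC_m -!evM -evD -qE expr2.
  rewrite mulrDr !mulrA [ev q * ev g]mulrC Egq evM -mK; ring.
have int_omega : integralOver (intr : int -> L) omega.
  apply: (integral_root_monic (p := 'X^2 + ((ev (r * w))%:P - ev s *: 'X))).
  - suff /Xn_add_monic_size[] : (size ((ev (r * w))%:P - ev s *: 'X)%R <= 2)%N by [].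
    rewrite (leq_trans (size_polyD _ _)) // geq_max size_polyN.
    rewrite (leq_trans (size_polyC_leq1 _)) //.
    by rewrite (leq_trans (size_scale_leq _ _)) // size_polyX.
  - rewrite rootE hornerD hornerXn hornerD hornerN hornerZ hornerC hornerX omegaE.
    by apply/eqP; ring.
  - apply/integral_poly => i; rewrite coefD coefXn.
    apply: integral_add; first exact: integral_nat.
    rewrite coefB coefC coefZ coefX; apply: integral_sub.
      by case: ifP => _; [apply: ev_int | apply: integral0].
    by apply: integral_mul; [apply: ev_int | apply: integral_nat].
have [c [cE _]] := uniq_dec omega (conj omega_in int_omega).
have [d [_ dU]] := uniq_dec (ev q) (conj (ev_in q) (ev_int q)).
(* The degree of [q] is below that of [f], so the coefficients of [q] are the coordinates of [ev q]
   in the power basis. *)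
have szq' : (size q <= (size f).-1)%N by rewrite -ltnS prednK // (leq_trans _ szq).
have dq : d = [ffun i : 'I_(size f).-1 => q`_i].
  apply: dU; rewrite /ev (@horner_coef_wide _ (size f).-1).
    by apply: eq_bigr => i _; rewrite ffunE coef_map /= mulrzl.
  by rewrite size_map_poly_id0 // (monicP q_mon) oner_eq0.
(* The same coordinates are [m] times those of [omega]; comparing them at the leading term of [q]
   gives [m] dividing 1. *)
have dc : d = [ffun i => c i * m%:Z].
  apply: dU; rewrite -mK cE mulr_suml; apply: eq_bigr => i _.
  by rewrite ffunE mulrzA mulr_natr.
have szq0 : (0 < size q)%N by rewrite size_poly_gt0 monic_neq0.
have lt_q : ((size q).-1 < (size f).-1)%N by rewrite prednK.
have := congr1 (fun e : {ffun _} => e (Ordinal lt_q)) (etrans (esym dq) dc).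
rewrite !ffunE /= -lead_coefE (monicP q_mon) => E1.
have : (m%:Z %| 1%R)%Z by rewrite E1 dvdz_mull.
by rewrite dvdzE /= dvdn1 => /eqP m_eq1; rewrite m_eq1 in m1.
Qed.

Section Quadratic.

Variable b : int.

Let g : {poly int} := 'X^2 + b *: 'X + b%:P.

Lemma V_rec n : V b n.+2 = - b * V b n.+1 - b * V b n.
Proof. by []. Qed.

(* The roots of x^2 + b x + b are X and - b - X modulo this polynomial. *)
Lemma V_mod_quadratic n : exists q : {poly int},
  'X^n + (- b%:P - 'X) ^+ n = (V b n)%:P + g * q.
Proof.
(* The recurrence has order two, so the induction carries two consecutive indices. *)
pose P k := exists q : {poly int},
  'X^k + (- b%:P - 'X) ^+ k = (V b k)%:P + g * q.
suff [] : P n /\ P n.+1 by [].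
elim: n => [|n [[q0 E0] [q1 E1]]]; split; last 2 first.
- by exists q1.
- exists ('X^n + (- b%:P - 'X) ^+ n - b%:P * q1 - b%:P * q0).
  rewrite V_rec polyCB !polyCM polyCN.
  have -> : (V b n.+1)%:P = 'X^(n.+1) + (- b%:P - 'X) ^+ n.+1 - g * q1.
    by rewrite E1 addrK.
  have -> : (V b n)%:P = 'X^n + (- b%:P - 'X) ^+ n - g * q0 by rewrite E0 addrK.
  by rewrite /g -mul_polyC !exprS; ring.
- by exists 0; rewrite mulr0 addr0 (_ : V b 0 = 1 + 1) // polyCD.
- by exists 0; rewrite /= polyCN; ring.
Qed.

(** With alpha and beta the roots of [g], the left side is (y - alpha^n)(y - beta^n) at y = X^n; it
    vanishes modulo [g] because X is itself a root there. *)
Lemma quadratic_dvd_power n : exists q : {poly int},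
  'X^(2 * n) - (V b n)%:P * 'X^n + (b ^+ n)%:P = g * q.
Proof.
have [q E] := V_mod_quadratic n.
(* The product of the two roots equals [b - g], and u - v divides u^n - v^n. *)
have [s Es] : exists s : {poly int}, ('X * (- b%:P - 'X)) ^+ n - (b ^+ n)%:P = g * s.
  rewrite polyC_exp subrXX.
  by eexists (- _); rewrite mulrN -mulNr; congr (_ * _); rewrite /g -mul_polyC; ring.
exists ('X^n * q - s); rewrite mulrBr -Es mulnC exprM exprMn.
have -> : (V b n)%:P = 'X^n + (- b%:P - 'X) ^+ n - g * q by rewrite E addrK.
ring.
Qed.

(** Frobenius distributes the power over the sum, and Fermat gives [b ^+ p = b] in ['F_p]. *)
Lemma quadratic_exp_prime p (hp : prime p) :
  map_poly intr (g ^+ p) =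
  map_poly intr ('X^(2 * p) + b *: 'X^p + b%:P) :> {poly 'F_p}.
Proof.
have pnatp : [pchar {poly 'F_p}].-nat p.
  by rewrite pnatE // pchar_poly pchar_Fp.
have bp : (b%:~R : 'F_p) ^+ p = b%:~R by rewrite -[RHS]expf_card card_Fp.
rewrite rmorphXn /= /g !rmorphD /= -!mul_polyC !rmorphM /= !map_polyXn.
rewrite map_polyX map_polyC /= !exprDn_pchar // !exprMn -polyC_exp bp.
by rewrite mul2n -addnn exprD.
Qed.

End Quadratic.

Lemma map_poly_Fp_eq {p : nat} (hp : prime p) {u v : {poly int}} :
  map_poly intr u = map_poly intr v :> {poly 'F_p} ->
  exists s, u = v + p%:Z%:P * s.
Proof.
move=> E; exists (map_poly (divz^~ p%:Z) (u - v)).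
apply/polyP => i; rewrite coefD coefCM coef_map_id0 ?div0z //.
have dv : (p%:Z %| (u - v)`_i)%Z.
  rewrite (dvdz_pcharf (pchar_Fp hp)) -[_%:~R]coef_map rmorphB /= E subrr.
  by rewrite coef0.
by rewrite mulrC divzK // coefB addrC subrK.
Qed.

Theorem corollary1p6 (b : int) (p : nat)
    (hb : 2 <= b)
    (hbsf : squarefree b)
    (hb4sf : squarefree (b - 4))
    (hp3 : (3 <= p)%N)
    (hp : prime p)
    (hD : (b ^+ 2 - 4 * b <> 0 %[mod p%:Z])%Z)
    (hV : (V b p = - b %[mod p%:Z ^+ 2])%Z)
    (hbp : (b ^+ p.-1 = 1 %[mod p%:Z ^+ 2])%Z) :
  ~ monogenic (G p b).
Proof.
pose g : {poly int} := 'X^2 + b *: 'X + b%:P.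
have [g_mon szg] : g \is monic /\ size g = 3.
  rewrite /g -addrA; apply: Xn_add_monic_size.
  rewrite (leq_trans (size_polyD _ _)) // geq_max.
  rewrite (leq_trans (size_scale_leq _ _)) ?size_polyX //.
  by rewrite (leq_trans (size_polyC_leq1 _)).
(* The coefficients are left free to cover both [g * q] and [G p b]. *)
have trinomial (c d : int) :
    'X^(2 * p) + c *: 'X^p + d%:P \is monic /\
    size ('X^(2 * p) + c *: 'X^p + d%:P) = (2 * p).+1.
  rewrite -addrA; apply: Xn_add_monic_size.
  rewrite (leq_trans (size_polyD _ _)) // geq_max.
  rewrite (leq_trans (size_scale_leq _ _)) ?size_polyXn ?(leq_trans (size_polyC_leq1 _)) //;
  lia.
have [q qE] := quadratic_dvd_power b p; rewrite -/g in qE.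
have [gq_mon szgq] : g * q \is monic /\ size (g * q) = (2 * p).+1.
  by rewrite -qE mul_polyC -scaleNr; apply: trinomial.
have q_mon : q \is monic by rewrite -(monicMl _ g_mon).
have /dvdzP[k kE] : (p%:Z ^+ 2 %| V b p - - b)%Z by rewrite -eqz_mod_dvd; apply/eqP.
have /dvdzP[l lE] : (p%:Z ^+ 2 %| b ^+ p.-1 - 1)%Z by rewrite -eqz_mod_dvd; apply/eqP.
have VE : V b p = k * p%:Z ^+ 2 - b by rewrite -kE opprK addrK.
have bpE : b ^+ p = b + b * (l * p%:Z ^+ 2).
  by rewrite -lE mulrBr mulr1 -exprS prednK ?prime_gt0 // addrC subrK.
(* The cofactor of p^2 collects the errors in [V b p = - b] and [b ^+ p = b]. *)
have GE : G p b = g * q + (p%:Z ^+ 2)%:P * (k%:P * 'X^p - (b * l)%:P).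
  by rewrite -qE VE bpE /G -mul_polyC !polyCD !polyCM polyCN; ring.
(* Modulo p, g q = G = g^p, and the nonzero factor [g] cancels in the domain [{poly 'F_p}]. *)
have [s sE] : exists s, q = g ^+ p.-1 + p%:Z%:P * s.
  apply: (map_poly_Fp_eq hp).
  have g0 : map_poly intr g != 0 :> {poly 'F_p} by rewrite monic_neq0 ?monic_map.
  apply: (mulfI g0); rewrite -!rmorphM /= -exprS prednK ?prime_gt0 //.
  rewrite quadratic_exp_prime // -[in RHS]/(G p b) GE rmorphD rmorphM /=.
  have p0 : (p%:Z)%:~R = 0 :> 'F_p by exact: pcharf0 (pchar_Fp hp).
  by rewrite map_polyC /= rmorphXn /= p0 expr0n mul0r addr0.
apply: (not_monogenic_of_factorization (w := g ^+ p.-2) (s := s) (prime_gt1 hp) q_mon _ GE).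
  by rewrite (proj2 (trinomial _ _)) -szgq size_monicM ?monic_neq0 // szg; lia.
by rewrite -exprS prednK ?sE //; lia.
Qed.
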